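(* Every melon graph is $3$-word-representable; that is, for every melon graph $M$ there is a $3$-uniform word over the vertex set of $M$ that represents $M$.
   Context: All graphs are finite and simple. A melon graph $M=(E_1,\ldots,E_m)$ ($m\ge 1$) is the graph formed as the union of $m$ paths $E_1,\ldots,E_m$ (the constituent paths), all having the same two distinct endpoints $0$ and $0'$, and pairwise sharing no vertices other than $0$ and $0'$; since $M$ is simple, at most one constituent path has length one (length = number of edges). Two letters $a\neq b$ alternate in a word $w$ if the subword of $w$ consisting of all occurrences of $a$ and $b$ is of the form $abab\cdots$ or $baba\cdots$ (of even or odd length). A word over $V$ is $k$-uniform if every letter of $V$ occurs in it exactly $k$ times. A word $w$ represents a graph $G=(V,E)$ if for all distinct $a,b\in V$: $\{a,b\}\in E$ if and only if $a$ and $b$ alternate in $w$. $G$ is $k$-word-representable if some $k$-uniform word over $V$ represents $G$. *)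

(* Defs.v *)
From mathcomp Require Import all_boot.
Set Implicit Arguments.
Unset Strict Implicit.
Unset Printing Implicit Defensive.

Section Words.
Variable T : finType.
Implicit Types (e : rel T) (w : seq T) (a b : T).

(* The word a b a b ... of length n. *)
Definition alt_word a b (n : nat) : seq T :=
  mkseq (fun i => if odd i then b else a) n.

Definition alternate a b w : Prop :=
  exists n, let sub := [seq c <- w | (c == a) || (c == b)] in
    sub = alt_word a b n \/ sub = alt_word b a n.

Definition uniform (k : nat) w : Prop := forall a, count_mem a w = k.

Definition represents w e : Prop :=
  forall a b, a != b -> e a b <-> alternate a b w.

Definition word_representable (k : nat) e : Prop :=
  exists w, uniform k w /\ represents w e.

End Words.

Section Graphs.
Variable T : finType.
Implicit Types (e : rel T) (s : seq T) (x y u v : T).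

Definition simple_graph e : Prop := symmetric e /\ irreflexive e.

(* A path is given by the list of its vertices, both endpoints included; its
   length (number of edges) is therefore (size s).-1. *)
Definition path_between x y s : Prop :=
  [/\ uniq s, ohead s = Some x & last x s = y].

Definition path_edge s u v : bool :=
  infix [:: u; v] s || infix [:: v; u] s.

Definition melon_of (m : nat) (E : 'I_m -> seq T) x y e : Prop :=
  [/\ x != y,
      forall i, path_between x y (E i),
      forall i j, i != j ->
        forall z, z \in E i -> z \in E j -> z = x \/ z = y
    & [/\ forall i j, size (E i) = 2 -> size (E j) = 2 -> i = j,
          forall z, exists i, z \in E i
        & forall u v, e u v <-> exists i, path_edge (E i) u v]].

Definition melon_graph e : Prop :=
  exists (m : nat) (E : 'I_m -> seq T) (x y : T), 0 < m /\ melon_of E x y e.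

End Graphs.

(* Main.v *)
Require Import Defs.
From mathcomp Require Import all_boot.

(** The word is grown together with the graph.  The word [w] represents the
    subgraph induced by a vertex set [S] when it is 3-uniform over [S] and
    alternation in [w] is adjacency inside [S] ([represents_on]).  Since every
    letter of [S] occurs equally often, two letters alternate exactly when they
    alternate around the circle ([cyc_alt]), so [w] may be rotated at will.

    - The two endpoints [x], [y] and the middle vertices of the constituent
      paths of length two are handled by an explicit word
      ([represents_on_base]).
    - A path of length at least three is added to an already represented set
      containing [x] and [y] ([represents_on_path]).  Up to rotation the word is
      [x B y C], where [B] and [C] each contain one [x] and one [y]
      ([represents_on_balanced]).  Replacing [x] by [u x u] and [y] by [u y]
      hangs a pendant vertex [u] on [x]: the two neighbouring copies of [u]
      keep it from alternating with any letter other than [x].  Replacing [x] by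
      [u v x u] and [y] by [v u y v] inserts a whole path [x - u - v - y].
      Pendant vertices lengthen the path from the side of [x], and the
      two-vertex insertion finally joins its end to [y].

    Every internal vertex of a constituent path has just its two neighbours on
    that path as neighbours in the melon graph ([melon_neighbours]), and the
    constituent paths share only [x] and [y], so they can be added one after
    the other. *)

Set Implicit Arguments.
Unset Strict Implicit.
Unset Printing Implicit Defensive.

(** * Cyclic alternation *)

Section Alternation.
Variable T : finType.
Implicit Types (a b c d x y u v z : T) (w s t B C : seq T).

Definition cyc_alt w a b :=
  cycle (fun c d => c != d) [seq c <- w | (c == a) || (c == b)].

Lemma cyc_altC w a b : cyc_alt w a b = cyc_alt w b a.
Proof. by congr cycle; apply: eq_filter => c; rewrite orbC. Qed.

Lemma cyc_alt_rot n w a b : cyc_alt (rot n w) a b = cyc_alt w a b.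
Proof.
by rewrite /cyc_alt -{2}(cat_take_drop n w) /rot !filter_cat -rot_size_cat
           rot_cycle.
Qed.

Lemma cycle_neq_cat_dup s t d :
  cycle (fun c d => c != d) (s ++ [:: d, d & t]) = false.
Proof. by rewrite -(rot_cycle (size s)) rot_size_cat /= eqxx. Qed.

Lemma alt_wordS a b n : alt_word a b n.+1 = a :: alt_word b a n.
Proof.
rewrite /alt_word /mkseq /= (iotaDl 1 0) -map_comp; congr cons.
by apply: eq_map => i /=; case: (odd i).
Qed.

Lemma count_alt_word a b n : a != b ->
  count_mem a (alt_word a b n) = odd n + count_mem b (alt_word a b n).
Proof.
move=> ab; have ba: (b == a) = false by rewrite eq_sym (negbTE ab).
elim/ltn_ind: n => -[|[|n]] IHn //.
  by rewrite alt_wordS /= eqxx (negbTE ab).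
rewrite !alt_wordS /= !eqxx ba (negbTE ab) IHn ?negbK //.
by rewrite add0n addnCA.
Qed.

Lemma cycle_alt_word a b n : a != b -> ~~ odd n ->
  cycle (fun c d => c != d) (alt_word a b n).
Proof.
move=> ab; have ba : b != a by rewrite eq_sym.
have alt_path k : path (fun c d => c != d) b (rcons (alt_word a b k.*2) a).
  by elim: k => [|k IHk]; rewrite ?doubleS ?alt_wordS /= ?ba // ab.
move=> /even_halfK <-; case: (n./2) => [|k] //.
by rewrite doubleS !alt_wordS /= ab alt_path.
Qed.

Lemma path_neq_alt_word c d t : path (fun c d => c != d) c t ->
  all (pred2 c d) t -> c :: t = alt_word c d (size t).+1.
Proof.
elim: t c d => [|c1 t IHt] c d //= /andP[cc1 pt] /andP[].
rewrite eq_sym (negbTE cc1) => /= /eqP c1d; subst c1 => at_.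
by rewrite alt_wordS -(IHt d c) //; apply: sub_all at_ => z; rewrite /= orbC.
Qed.

(** Equal numbers of occurrences force the alternating subword to have even
    length, so that its first and last letters differ; without this the word
    [aba] would alternate but not cyclically. *)
Lemma alternateP a b w : a != b -> count_mem a w = count_mem b w ->
  alternate a b w <-> cyc_alt w a b.
Proof.
move=> ab; have ba : b != a by rewrite eq_sym.
set s := [seq c <- w | (c == a) || (c == b)].
have <- : count_mem a s = count_mem a w.
  rewrite count_filter; apply: eq_count => c /=.
  by case: eqP.
have <- : count_mem b s = count_mem b w.
  rewrite count_filter; apply: eq_count => c /=.
  by rewrite orbC; case: eqP.
move=> cnt; rewrite /cyc_alt -/s; split => [[n /= sE]|].
  have nE : ~~ odd n.
    apply/negP => n_odd; move: cnt; case: sE; rewrite -/s => ->;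
      rewrite (count_alt_word _ ab, count_alt_word _ ba) n_odd => /eqP;
      by rewrite ?[_ == _ + _]eq_sym -{2}[count_mem _ _]add0n eqn_add2r.
  by case: sE; rewrite -/s => ->; apply: cycle_alt_word.
have := filter_all (fun c => (c == a) || (c == b)) w; rewrite -/s.
rewrite /alternate -/s; case: {cnt} s => [|c t]; first by exists 0; left.
rewrite /= rcons_path => /andP[/orP[]/eqP-> at_] /andP[pt _];
  exists (size t).+1; [left|right]; apply: path_neq_alt_word => //.
by apply: sub_all at_ => z /=; rewrite orbC.
Qed.

(** * Words representing induced subgraphs *)

Section Represent.
Variable e : rel T.
Hypothesis e_sym : symmetric e.
Implicit Types S : {set T}.

Definition represents_on S w :=
  (forall a, count_mem a w = 3 * (a \in S)) /\
  {in S &, forall a b, a != b -> e a b = cyc_alt w a b}.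

Lemma represents_on_rot n S w : represents_on S w -> represents_on S (rot n w).
Proof.
case=> cnt alt; split=> [a|a b aS bS ab].
  by rewrite -cnt; apply/permP; rewrite perm_rot.
by rewrite cyc_alt_rot alt.
Qed.

Lemma mem_represents_on S w a : represents_on S w -> (a \in w) = (a \in S).
Proof. by case=> cnt _; rewrite -has_pred1 has_count cnt; case: (a \in S). Qed.

(** Inserting copies of a new letter does not affect how the old letters
    alternate, so only the pairs involving the new letter have to be checked. *)
Lemma represents_on_add S w w' u : represents_on S w ->
    u \notin S -> [seq c <- w' | c != u] = w -> count_mem u w' = 3 ->
    {in S, forall z, e u z = cyc_alt w' u z} ->
  represents_on (u |: S) w'.
Proof.
move=> [cnt alt] uS ww' cu au; split=> [a|].
  rewrite in_setU1; have [->|au'] /= := eqVneq a u; first by rewrite cu.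
  rewrite -cnt -ww' count_filter; apply: eq_count => c /=.
  by have [->|] := eqVneq c a.
have alt' a b : a != u -> b != u -> cyc_alt w' a b = cyc_alt w a b.
  move=> nau nbu; rewrite /cyc_alt -ww' -filter_predI; congr cycle.
  apply: eq_filter => c /=; have [->|_] := eqVneq c u; last by rewrite andbT.
  by rewrite ![u == _]eq_sym (negbTE nau) (negbTE nbu).
move=> a b; rewrite !in_setU1.
have [->|au'] /= := eqVneq a u; have [->|bu] /= := eqVneq b u.
- by [].
- by move=> _ bS _; apply: au.
- by move=> aS _ _; rewrite e_sym au // cyc_altC.
- by move=> aS bS ab; rewrite alt' // alt.
Qed.

Lemma filter_count1 s u x : u \notin s -> count_mem x s = 1 ->
  [seq c <- s | (c == u) || (c == x)] = [:: x].
Proof.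
move=> us cx; rewrite -[RHS]/(nseq 1 x) -cx -size_filter.
rewrite -(@eq_in_filter _ (pred1 x)); first exact/all_pred1P/filter_all.
by move=> c cs /=; have [cu|//] := eqVneq c u; rewrite -cu cs in us.
Qed.

(** The two copies of [u] around [x] leave [u] alternating with no letter but
    [x]; around the circle, the third copy separates the other two
    occurrences of [x], one in [B] and one in [C]. *)
Lemma represents_on_leaf S x u B C : represents_on S (x :: B ++ C) ->
    count_mem x B = 1 -> count_mem x C = 1 -> u \notin S ->
    {in S, forall z, e u z = (z == x)} ->
  represents_on (u |: S) ([:: u, x, u & B] ++ u :: C).
Proof.
move=> Sw xB xC uS eu; have uw := mem_represents_on u Sw.
move: uw; rewrite (negbTE uS) inE mem_cat => /norP[ux /norP[uB uC]].
have xu : (x == u) = false by rewrite eq_sym (negbTE ux).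
apply: (represents_on_add Sw) => // [||z zS].
- rewrite filter_cat /= eqxx xu /= -filter_cat; congr cons.
  apply/all_filterP/allP=> c; rewrite mem_cat; apply: contraTneq => ->.
  by apply/norP.
- by rewrite count_cat /= eqxx xu (count_memPn uB) (count_memPn uC).
rewrite eu // /cyc_alt filter_cat /= eqxx /=.
have [->|zx] := eqVneq z x.
  by rewrite orbT (filter_count1 uB xB) (filter_count1 uC xC) /= xu ux.
by rewrite xu /= eqxx.
Qed.

(** In the word [u v x u B v u y v C], rotated here to begin at [v u y v], the
    block [u v x u] allows [u] to alternate with [v] and [x] only, and
    [v u y v] allows [v] to alternate with [u] and [y] only.  The subword on
    [u], [v] is [uvuvuv].  The third copy of [u] lies next to [y] and the third
    copy of [v] next to [x]; the occurrences of [x] and [y] in [B] and [C] make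
    these the right places for [u] to alternate with [x] and [v] with [y]. *)
Lemma represents_on_close S x y u v B C : represents_on S (x :: B ++ y :: C) ->
    x != y -> count_mem x B = 1 -> count_mem x C = 1 ->
    count_mem y B = 1 -> count_mem y C = 1 -> u \notin S -> v \notin S ->
    u != v -> {in S, forall z, e u z = (z == x)} ->
    {in S, forall z, e v z = (z == y)} -> e u v ->
  represents_on (v |: (u |: S)) ([:: v, u, y, v & C] ++ [:: u, v, x, u & B]).
Proof.
move=> Sw xy xB xC yB yC uS vS uv eu ev euv.
have xC' : count_mem x (y :: C) = 1 by rewrite /= eq_sym (negbTE xy).
have [uw vw] := (mem_represents_on u Sw, mem_represents_on v Sw).
move: uw; rewrite (negbTE uS) inE mem_cat inE.
case/norP=> ux /norP[uB /norP[uy uC]].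
move: vw; rewrite (negbTE vS) inE mem_cat inE.
case/norP=> vx /norP[vB /norP[vy vC]].
(* Without the copies of v, this is u as a pendant vertex on x. *)
have Sw1 : represents_on (u |: S) ([:: u, y & C] ++ [:: u, x, u & B]).
  rewrite -rot_size_cat; apply: represents_on_rot.
  exact: represents_on_leaf.
have [xu yu] : (x == u) = false /\ (y == u) = false.
  by rewrite ![_ == u]eq_sym !(negbTE ux, negbTE uy).
have [xv yv] : (x == v) = false /\ (y == v) = false.
  by rewrite ![_ == v]eq_sym !(negbTE vx, negbTE vy).
have vu : (v == u) = false by rewrite eq_sym (negbTE uv).
have fv s : v \notin s -> [seq c <- s | c != v] = s.
  by move=> vs; apply/all_filterP/allP=> c; apply: contraTneq => ->.
apply: (represents_on_add Sw1) => // [|||z].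
- by rewrite in_setU1 vu.
- by rewrite filter_cat /= eqxx uv xv yv /= !fv.
- rewrite count_cat /= eqxx xv yv (negbTE uv).
  by rewrite (count_memPn vB) (count_memPn vC).
rewrite in_setU1 /cyc_alt filter_cat /= !eqxx /=.
case/predU1P=> [->|zS].
  rewrite e_sym euv eqxx orbT xv xu yv yu /=.
  rewrite !(@eq_in_filter _ _ pred0) ?filter_pred0 /= ?vu ?uv //=;
    move=> c cs /=; apply/negbTE/norP; split; apply: contraTneq cs => ->//.
have uz : (u == z) = false by apply: contraNF uS => /eqP->.
rewrite ev // uz (negbTE uv) /= xv yv /=.
have [->|zy] := eqVneq z y.
  rewrite /= (negbTE xy) (filter_count1 vB yB) (filter_count1 vC yC) /=.
  by rewrite ?yv ?vy.
by rewrite /= eqxx.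
Qed.


Lemma filter_eq_cons (p : pred T) w c t : [seq d <- w | p d] = c :: t ->
  exists A w', [/\ w = A ++ c :: w', [seq d <- A | p d] = [::], p c
                 & [seq d <- w' | p d] = t].
Proof.
elim: w => [|d w IHw] //=; case: ifP => pd.
  by case=> <- <-; exists [::], w.
by case/IHw => A [w' [-> pA pc pw']]; exists (d :: A), w'; rewrite /= pd.
Qed.

Lemma filter_eq_cat (p : pred T) w s t : [seq d <- w | p d] = s ++ t ->
  exists w1 w2, [/\ w = w1 ++ w2, [seq d <- w1 | p d] = s
                  & [seq d <- w2 | p d] = t].
Proof.
elim: s w => [|c s IHs] w /=; first by exists [::], w.
case/filter_eq_cons => A [w' [-> pA pc /IHs[w1 [w2 [-> pw1 pw2]]]]].
by exists (A ++ c :: w1), w2; rewrite filter_cat -catA /= pA pc pw1.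
Qed.

(** * Cutting a word between two letters *)

(** A finite check on the 20 words with three [true] and three [false]; up to
    rotation there are four of them. *)
Lemma balanced_bits (s : bitseq) : size s = 6 -> count id s = 3 ->
  exists n p q, rot n s = [:: true; p; ~~ p; false; q; ~~ q].
Proof.
move=> s6 s3.
have /hasP[n _ /eqP rotE] : has (fun n => let t := rot n s in
    t == [:: true; nth true t 1; ~~ nth true t 1;
             false; nth true t 4; ~~ nth true t 4]) (iota 0 6).
  by case: s s6 s3 => [|[] [|[] [|[] [|[] [|[] [|[] []]]]]]].
by exists n, (nth true (rot n s) 1), (nth true (rot n s) 4); exact: rotE.
Qed.

(** Only the subword on [x], [y] matters: once rotated and cut as
    [balanced_bits] says, the cut lifts to the whole word. *)
Lemma represents_on_balanced S w x y : represents_on S w ->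
    x != y -> x \in S -> y \in S ->
  exists B C, [/\ represents_on S (x :: B ++ y :: C),
                  count_mem x B = 1 /\ count_mem x C = 1
                & count_mem y B = 1 /\ count_mem y C = 1].
Proof.
move=> Sw xy xS yS; pose p c := (c == x) || (c == y).
pose f (b : bool) := if b then x else y.
have yx : y == x = false by rewrite eq_sym (negbTE xy).
have pE : [seq c <- w | p c] = map f [seq c == x | c <- [seq c <- w | p c]].
  rewrite -map_comp; apply/esym/map_id_in => c; rewrite mem_filter /f /p /=.
  by case: eqP => [->|_] //= /andP[/eqP->].
have cnt_p a t : p a -> count_mem a t = count_mem a [seq c <- t | p c].
  move=> pa; rewrite count_filter; apply: eq_count => c /=.
  by have [->|] := eqVneq c a.
have [px py] : p x /\ p y by rewrite /p !eqxx orbT.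
have [cx cy] : count_mem x w = 3 /\ count_mem y w = 3.
  by case: Sw => cnt _; rewrite !cnt xS yS.
have [||n [b [c bits]]] :=
  @balanced_bits [seq c == x | c <- [seq c <- w | p c]].
- have := count_predUI (pred1 x) (pred1 y) w.
  rewrite cx cy size_map size_filter.
  rewrite (@eq_count _ (predI _ _) pred0) ?count_pred0 ?addn0 // => c /=.
  by have [->|] := eqVneq c x; rewrite ?(negbTE xy).
- by rewrite count_map -[RHS]cx [RHS]cnt_p.
case/esym/filter_eq_cat: (cat_take_drop n [seq c <- w | p c]).
move=> w1 [w2 [wE w1E w2E]].
have : [seq d <- w2 ++ w1 | p d]
       = x :: [:: f b; f (~~ b)] ++ [:: y; f c; f (~~ c)].
  by rewrite -[RHS]/(map f [:: true; b; ~~ b; false; c; ~~ c]) -bits map_rot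
             -pE filter_cat w1E w2E.
have Sw' : represents_on S (w2 ++ w1).
  by rewrite -rot_size_cat -wE; apply: represents_on_rot.
case/filter_eq_cons => A [w3 [w'E pA _ ]].
case/filter_eq_cat => B [w4 [w3E pB]].
case/filter_eq_cons => A' [C [w4E pA' _ pC]].
exists (B ++ A'), (C ++ A); split.
- have -> : x :: (B ++ A') ++ y :: C ++ A = rot (size A) (w2 ++ w1).
    by rewrite w'E w3E w4E rot_size_cat /= -!catA.
  exact: represents_on_rot.
- by split; rewrite cnt_p // filter_cat ?pB ?pC ?pA ?pA' /=;
    case: (b) (c) => [] []; rewrite /= eqxx yx.
- by split; rewrite cnt_p // filter_cat ?pB ?pC ?pA ?pA' /=;
    case: (b) (c) => [] []; rewrite /= eqxx (negbTE xy).
Qed.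

(** * The base words and the addition of a path *)

(** The subword on two letters of [A] is [l ++ rev l ++ l], in which the last
    letter of [l] is doubled. *)
Lemma represents_on_alternating_blocks (A : {set T}) :
    {in A &, forall a b, e a b = false} ->
  represents_on A (enum A ++ rev (enum A) ++ enum A).
Proof.
move=> eA; split=> [a|a b aA bA ab].
  rewrite !count_cat count_rev !(count_uniq_mem _ (enum_uniq _)) mem_enum.
  by rewrite !mulSn addn0.
rewrite eA // /cyc_alt !filter_cat filter_rev.
have : a \in [seq c <- enum A | (c == a) || (c == b)].
  by rewrite mem_filter eqxx mem_enum.
case/lastP: [seq c <- enum A | _] => // s d _.
by rewrite rev_rcons -cats1 -!catA cycle_neq_cat_dup.
Qed.

(** With [r] enumerating [A], the word is [r x y (rev r) m r x y].  Both [x] and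
    [y] occur once after each block, hence alternate with every letter of [A];
    the order of [x] and [y] in the middle occurrence [m] decides whether they
    alternate with each other. *)
Lemma represents_on_base (A : {set T}) x y :
    x != y -> x \notin A -> y \notin A ->
    {in A &, forall a b, e a b = false} ->
    {in A, forall a, e x a} -> {in A, forall a, e y a} ->
  exists w, represents_on (y |: (x |: A)) w.
Proof.
move=> xy xA yA eA xa ya; set r := enum A.
have yx : y == x = false by rewrite eq_sym (negbTE xy).
have mid a z : a \in A -> z \notin A ->
    [seq c <- r | (c == z) || (c == a)] = [:: a].
  move=> aA zA; apply: filter_count1; first by rewrite mem_enum.
  by rewrite (count_uniq_mem _ (enum_uniq _)) mem_enum aA.
have frees z : z \notin A -> [seq c <- r | c != z] = r.
  move=> zA; apply/all_filterP/allP=> c; apply: contraTneq => ->.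
  by rewrite mem_enum.
have count_r z : z \notin A -> count_mem z r = 0.
  by move=> zA; apply/count_memPn; rewrite mem_enum.
have Ax : represents_on (x |: A) (r ++ x :: rev r ++ x :: r ++ [:: x]).
  apply: (represents_on_add (represents_on_alternating_blocks eA)) => //.
  - by do 3 rewrite !(filter_cat, filter_rev) /= eqxx; rewrite !frees // cats0.
  - by do 3 rewrite !(count_cat, count_rev) /=; rewrite eqxx !count_r.
  move=> a aA; rewrite xa //; apply/esym.
  have ax : (a == x) = false by apply: contraNF xA => /eqP<-.
  have xa' : (x == a) = false by rewrite eq_sym.
  rewrite /cyc_alt; do 3 rewrite !(filter_cat, filter_rev) /=.
  by rewrite !mid // eqxx /= ax xa'.
set m := if e x y then [:: x; y] else [:: y; x].
exists (r ++ [:: x; y] ++ rev r ++ m ++ r ++ [:: x; y]).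
have m_x : [seq c <- m | c != y] = [:: x].
  by rewrite /m; case: ifP => _; rewrite /= eqxx xy.
apply: (represents_on_add Ax).
- by rewrite in_setU1 yx.
- by rewrite !(filter_cat, filter_rev) m_x /= eqxx xy !frees.
- rewrite !(count_cat, count_rev) /= eqxx (negbTE xy) !count_r //.
  by rewrite /m; case: ifP => _; rewrite /= eqxx (negbTE xy).
move=> z; rewrite in_setU1 /cyc_alt !(filter_cat, filter_rev).
case/predU1P => [->|zA].
  have -> : [seq c <- r | (c == y) || (c == x)] = [::].
    apply/eqP; rewrite -[_ == _]negbK -has_filter; apply/hasPn => c.
    rewrite mem_enum => cA; rewrite negb_or.
    by rewrite !(contraTneq _ cA) // => ->.
  rewrite e_sym /m; case: ifP => _;
    by rewrite /= !eqxx ?(negbTE xy) ?yx ?orbT /= ?eqxx ?xy ?yx.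
have zy : z == y = false by apply: contraNF yA => /eqP<-.
have zx : x == z = false by apply: contraNF xA => /eqP->.
have -> : [seq c <- m | (c == y) || (c == z)] = [:: y].
  by rewrite /m; case: ifP => _; rewrite /= eqxx (negbTE xy) zx.
by rewrite ya // mid // /= eqxx (negbTE xy) zx /= zy eq_sym zy.
Qed.

(** Induction on the internal vertices [p]: as long as at least three are left,
    the first one is attached as a pendant vertex and becomes the new starting
    point; the last two are inserted together.  The neighbourhood hypothesis
    is stated on consecutive triples so that it passes to the shorter path. *)
Lemma represents_on_path y p x S : 1 < size p -> uniq (x :: rcons p y) ->
    x \in S -> y \in S -> {in p, forall z, z \notin S} ->
    (forall s a u b t, x :: rcons p y = s ++ [:: a, u, b & t] ->
       forall z, e u z = (z == a) || (z == b)) ->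
    (exists w, represents_on S w) ->
  exists w, represents_on (S :|: [set z in p]) w.
Proof.
elim: p x S => [|u [|v p] IHp] x S //= _ uniq_p xS yS pS nbr [w Sw].
have xy : x != y.
  apply: contraTneq uniq_p => ->.
  by rewrite !inE mem_rcons inE eqxx !orbT.
have [B [C [Sw' [xB xC] [yB yC]]]] := represents_on_balanced Sw xy xS yS.
have uS : u \notin S by apply: pS; rewrite mem_head.
have vS : v \notin S by apply: pS; rewrite !inE eqxx orbT.
have uv : u != v.
  by apply: contraTneq uniq_p => ->; rewrite !inE eqxx /= andbF.
have eu z : z \in S -> e u z = (z == x).
  move=> zS; rewrite (nbr [::] x u v (rcons p y)) //.
  have [zv|_] := eqVneq z v; last by rewrite orbF.
  by rewrite -zv zS in vS.
case: p => [|v' p] in IHp uniq_p pS nbr *.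
  have ev z : z \in S -> e v z = (z == y).
    move=> zS; rewrite (nbr [:: x] u v y [::]) //.
    have [zu|//] := eqVneq z u.
    by rewrite -zu zS in uS.
  have euv : e u v by rewrite (nbr [::] x u v [:: y]) ?eqxx ?orbT.
  exists ([:: v, u, y, v & C] ++ [:: u, v, x, u & B]).
  have -> : S :|: [set z in [:: u; v]] = v |: (u |: S).
    by apply/setP=> z; rewrite !inE orbC orbCA orbA -!orbA orbCA.
  exact: represents_on_close.
have -> : S :|: [set z in [:: u, v, v' & p]]
          = (u |: S) :|: [set z in [:: v, v' & p]].
  by apply/setP=> z; rewrite !inE orbCA !orbA.
apply: (IHp u) => //.
- by case/andP: uniq_p.
- by rewrite !inE eqxx.
- by rewrite !inE yS orbT.
- move=> z zp; rewrite in_setU1 negb_or [X in _ && X]pS ?andbT; last first.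
    by rewrite inE zp orbT.
  case/and3P: uniq_p => _.
  rewrite -rcons_cons mem_rcons inE negb_or => /andP[_].
  by move=> unp _; apply: contraNneq unp => <-.
- by move=> s a u' b t sE; apply: (nbr (x :: s) a u' b t); rewrite /= -sE.
exists ([:: u, x, u & B] ++ u :: y :: C); apply: represents_on_leaf => //=.
by rewrite eq_sym (negbTE xy).
Qed.

Lemma represents_on_setT w : represents_on setT w ->
  word_representable 3 e.
Proof.
case=> cnt alt; exists w; split=> [a|a b ab]; first by rewrite cnt in_setT.
rewrite alt ?in_setT //; apply: iff_sym.
by apply: alternateP; rewrite ?cnt ?in_setT.
Qed.

End Represent.

(** * Melon graphs *)

Lemma path_edge_neighbours s a u b t z :
    uniq (s ++ [:: a, u, b & t]) ->
  path_edge (s ++ [:: a, u, b & t]) u z = (z == a) || (z == b).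
Proof.
rewrite -[[:: a, _ & _]]cat1s catA cats1 => us.
rewrite /path_edge orbC; congr orb.
  apply/infixP/eqP => [[s' [t' /eqP]]|->].
    rewrite -[[:: z; u] ++ t']cat1s catA cats1 uniq_eqseq_pivotl //.
    by case/andP=> /eqP/rcons_inj[_ ->].
  by exists s, (b :: t); rewrite -cats1 -catA.
apply/infixP/eqP => [[s' [t' /eqP]]|->].
  by rewrite uniq_eqseq_pivotl // => /andP[_ /eqP[->]].
by exists (rcons s a), t.
Qed.

Lemma path_edge_mem s u z : path_edge s u z -> u \in s.
Proof.
by case/orP => /mem_infix; apply; rewrite !inE eqxx ?orbT.
Qed.

Lemma path_betweenP x y s : x != y -> path_between x y s ->
  exists p, s = x :: rcons p y.
Proof.
move=> xy [_]; case: s => // c s [->] /=; case/lastP: s => [/= xy'|p d].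
  by rewrite xy' eqxx in xy.
by rewrite last_rcons => ->; exists p.
Qed.

(** A vertex with a predecessor and a successor on a constituent path is
    neither endpoint, so no other constituent path meets it. *)
Lemma melon_neighbours (m : nat) (E : 'I_m -> seq T) x y e i s a u b t :
    melon_of E x y e -> E i = s ++ [:: a, u, b & t] ->
  forall z, e u z = (z == a) || (z == b).
Proof.
case=> xy bet disj [_ _ eE] Ei z.
have [uE hE lE] := bet i; rewrite Ei in uE hE lE.
rewrite -(path_edge_neighbours z uE) -Ei.
apply/idP/idP => [/eE[j ej]|ei]; last first.
  by apply/eE; exists i.
have [<-//|ji] := eqVneq j i.
have uEi : u \in E i by rewrite Ei mem_cat !inE eqxx !orbT.
case: (disj _ _ ji _ (path_edge_mem ej) uEi) => ux.
  case: s hE uE {Ei lE uEi} => [|c s] [cx] /=;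
    by rewrite cx ux !(inE, mem_cat) eqxx ?orbT.
move: uE; rewrite cat_uniq => /and3P[_ _ /=/and3P[_]].
by rewrite ux -lE last_cat /= mem_last.
Qed.

End Alternation.

Theorem theorem2 (T : finType) (e : rel T) (he : simple_graph e)
    (hM : melon_graph e) : word_representable 3 e.
Proof.
case: he => e_sym _; case: hM => m [E [x [y [_ hM]]]].
have nbr := melon_neighbours hM.
case: hM => xy bet disj [_ covE _].
(* These paths are too short for represents_on_path, so their middle vertices
   have to be present in the base word. *)
pose A := [set z | [exists i, E i == [:: x; z; y]]].
have AE z : z \in A -> exists i, E i = [:: x; z; y].
  by rewrite inE => /existsP[i /eqP]; exists i.
have eA a z : a \in A -> e a z = (z == x) || (z == y).
  by case/AE=> i Ei; apply: (nbr i [::] x a y [::]).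
have xyA z : z \in A -> z != x /\ z != y.
  case/AE=> i Ei; have [uE _ _] := bet i; rewrite Ei /= !inE in uE.
  by case/and3P: uE => /norP[xz _] zy _; rewrite eq_sym.
pose S L := (y |: (x |: A)) :|: [set z | has (fun i => z \in E i) L].
suff SP L : uniq L -> exists w, represents_on e (S L) w.
  have [w Sw] := SP _ (enum_uniq 'I_m).
  apply: (@represents_on_setT _ _ w); rewrite -[setT](_ : S (enum 'I_m) = _) //.
  apply/setP=> z; rewrite !inE; apply/orP; right; have [i zi] := covE z.
  by apply/hasP; exists i; rewrite ?mem_enum.
elim: L => [_|i L IHL /= /andP[iL uL]].
  have -> : S [::] = y |: (x |: A) by apply/setP=> z; rewrite !inE orbF.
  apply: represents_on_base => //.
  - by apply/negP => /xyA[]; rewrite eqxx.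
  - by apply/negP => /xyA[_]; rewrite eqxx.
  - by move=> a b /eA-> /xyA[/negbTE-> /negbTE->].
  - by move=> a /eA; rewrite e_sym => ->; rewrite eqxx.
  - by move=> a /eA; rewrite e_sym => ->; rewrite eqxx orbT.
have [p Ei] := path_betweenP xy (bet i).
have [uE _ _] := bet i; rewrite Ei in uE.
have -> : S (i :: L) = S L :|: [set z in p].
  apply/setP=> z; rewrite !inE /= Ei inE mem_rcons inE -!orbA.
  by case: (z == x) (z == y) (z \in p) (has _ L) => [] [] [] []; rewrite ?orbT.
(* With at most one internal vertex, the path brings no new vertex. *)
have [p_gt1|p_le1] := ltnP 1 (size p); last first.
  suff -> : S L :|: [set z in p] = S L by apply: IHL.
  apply/setUidPl/subsetP=> z; rewrite inE => zp.
  case: p p_le1 zp Ei {uE} => [|a [|//]] // _; rewrite inE => /eqP-> Ei.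
  have aA : a \in A by rewrite inE; apply/existsP; exists i; rewrite Ei.
  by rewrite !in_setU aA !orbT.
apply: (@represents_on_path _ _ e_sym y p x _ p_gt1 uE) (IHL uL) => //.
- by rewrite !inE eqxx orbT.
- by rewrite !inE eqxx.
- move=> z zp.
  have zE : z \in E i by rewrite Ei inE mem_rcons inE zp !orbT.
  have [zx zy] : z != x /\ z != y.
    move: uE; rewrite /= rcons_uniq mem_rcons inE => /and3P[/norP[_ xp] yp _].
    by split; apply: contraTneq zp => ->.
  have own j : z \in E j -> j = i.
    move=> zj; apply: contraTeq isT => ji.
    by case: (disj _ _ ji _ zj zE) => zE'; rewrite zE' eqxx in zx zy.
  rewrite in_setU in_setU1 in_setU1 (negbTE zx) (negbTE zy) /=.
  apply/norP; split.
    apply/negP => /AE[j Ej].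
    have ji : j = i by apply: own; rewrite Ej !inE eqxx orbT.
    by move: Ej p_gt1; rewrite ji Ei => -[]; case: (p) => [|a [|b [|c q]]].
  by rewrite inE; apply/hasPn => j jL; apply: contraNN iL => /own <-.
by move=> s a u b t sE; apply: (nbr i s a u b t); rewrite Ei.
Qed.
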